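(* Let $p,q\in[1,\infty]$, $\eta>0$, $d\in\mathbb{N}^*$, $\mu_1,\dots,\mu_d\in\mathbb{R}^*_+$ with $\mu_1\ge\dots\ge\mu_d>0$, and let $\mathcal{E}_p^d$ be the $p$-ellipsoid in $\mathbb{R}^d$ with semi-axes $\{\mu_1,\dots,\mu_d\}$. Then $$N\left(\varepsilon;\mathcal{E}^d_p,\|\cdot\|_q\right)^{1/d}\,\varepsilon\ \ge\ V_{p,q,d}\,\bar\mu_d,\qquad\text{for all }\varepsilon>0.$$ Moreover, there exists a sequence $\{\kappa(d)\}_{d\in\mathbb{N}^*}$, depending only on the dimension $d$, satisfying $$\kappa(d)=1+O_{d\to\infty}\left(\frac{\log d}{d}\right),$$ such that the following two statements hold. [FD1] One has $$\left(N\left(\varepsilon;\mathcal{E}^d_p,\|\cdot\|_q\right)-1\right)^{1/d}\varepsilon\ \le\ \kappa(d)\,(1+\eta)\,V_{p,q,d}\,\bar\mu_d,\qquad\text{for all }\varepsilon\in\left(0,\ \eta\,d^{-(1/p-1/q)_+}\mu_d\right].$$ [FD2] One has $$\left(N\left(\varepsilon;\mathcal{E}^d_p,\|\cdot\|_q\right)-1\right)^{1/d}\varepsilon\ \le\ \kappa(d)\,(1+\eta)\,d^{(1/q-1/p)}\,\bar\mu_d,$$ whenever $p\ge q$ and $\varepsilon\in\left(0,\ \eta\,d^{(1/q-1/p)}\mu_d\right]$.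
   Context: $\mathbb{N}^*=\{1,2,\dots\}$, $\mathbb{R}^*_+=(0,\infty)$, $\log$ is the logarithm to base 2, $(x)_+=\max\{x,0\}$, and $1/\infty=0$. For $p\in[1,\infty]$ and positive semi-axes $\mu_1\ge\dots\ge\mu_d>0$, the $p$-ellipsoid is $\mathcal{E}_p^d=\{x\in\mathbb{R}^d:\|x\|_{p,\mu}\le1\}$, where $\|x\|_{p,\mu}=\left(\sum_{n=1}^d|x_n/\mu_n|^p\right)^{1/p}$ if $p<\infty$ and $\|x\|_{\infty,\mu}=\max_{1\le n\le d}|x_n/\mu_n|$. $\bar\mu_d=(\mu_1\cdots\mu_d)^{1/d}$ is the geometric mean. $\|\cdot\|_q$ is the $\ell^q$-norm on $\mathbb{R}^d$. The covering number $N(\varepsilon;\mathcal{K},\|\cdot\|_q)$ of $\mathcal{K}\subseteq\mathbb{R}^d$ is the smallest cardinality of a set $\{x_1,\dots,x_N\}\subseteq\mathbb{R}^d$ such that each $x\in\mathcal{K}$ satisfies $\|x-x_i\|_q\le\varepsilon$ for some $i$. $V_{p,q,d}=\left(\mathrm{vol}(\mathcal{B}_p)/\mathrm{vol}(\mathcal{B}_q)\right)^{1/d}$, where $\mathcal{B}_p,\mathcal{B}_q$ are the unit balls of $\|\cdot\|_p$ and $\|\cdot\|_q$ in $\mathbb{R}^d$. *)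

(* Defs.v *)
From HB Require Import structures.
From mathcomp Require Import all_boot all_order all_algebra finmap.
From mathcomp Require Import all_classical all_reals all_analysis.

Set Implicit Arguments.
Unset Strict Implicit.
Unset Printing Implicit Defensive.

Import Order.TTheory GRing.Theory Num.Theory.
Import numFieldNormedType.Exports.

Local Open Scope classical_set_scope.
Local Open Scope ring_scope.

Section TupleMeasure.
Context d (T : measurableType d) (R : realType).

Definition consT n (x : (T * n.-tuple T)%type) : n.+1.-tuple T :=
  [tuple of x.1 :: x.2].

Lemma measurable_consT n : measurable_fun setT (@consT n).
Proof. exact: measurable_cons. Qed.

Section cons_measure.
Context (m1 : {sigma_finite_measure set T -> \bar R}) (n : nat)
  (m2 : {sigma_finite_measure set (n.-tuple T) -> \bar R}).

Definition cons_measure : set (n.+1.-tuple T) -> \bar R :=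
  pushforward (m1 \x m2)%E (@consT n).

HB.instance Definition _ := Measure.copy cons_measure
  (measure_function_pushforward__canonical__measure_function_Measure
    (m1 \x m2)%E (@measurable_consT n)).

Let sigma_finite_cons_measure : sigma_finite setT cons_measure.
Proof.
have /sigma_finiteP[F [TF ndF Foo]] := sigma_finiteT m1.
have /sigma_finiteP[G [TG ndG Goo]] := sigma_finiteT m2.
exists (fun k => [set t | F k (thead t) /\ G k [tuple of behead t]]).
  apply/esym; rewrite -subTset => t _.
  have [k1 _ Fk1] : (\bigcup_k F k) (thead t) by rewrite -TF.
  have [k2 _ Gk2] : (\bigcup_k G k) [tuple of behead t] by rewrite -TG.
  exists (maxn k1 k2) => //=; split.
    by move: (thead t) Fk1; exact/subsetPset/ndF/leq_maxl.
  by move: [tuple of behead t] Gk2; exact/subsetPset/ndG/leq_maxr.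
move=> k; have [mFk Fkoo] := Foo k; have [mGk Gkoo] := Goo k; split.
  apply: measurableI; rewrite -[X in measurable X]setTI.
    exact: measurable_tnth.
  exact: measurable_behead.
rewrite /cons_measure /pushforward (_ : _ @^-1` _ = F k `*` G k); last first.
  have consK (x : T * n.-tuple T) : [tuple of behead (consT x)] = x.2.
    exact: val_inj.
  by apply/seteqP; split => -[x t] /= [Fx]; rewrite (consK (x, t)).
by rewrite product_measure1E// lte_mul_pinfty// ge0_fin_numE.
Qed.

HB.instance Definition _ := Measure_isSigmaFinite.Build _ _ _ cons_measure
  sigma_finite_cons_measure.

End cons_measure.

Fixpoint tuple_measure (m : {sigma_finite_measure set T -> \bar R}) (n : nat) :
    {sigma_finite_measure set (n.-tuple T) -> \bar R} :=
  match n with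
  | 0 => dirac ([tuple] : 0.-tuple T)
  | k.+1 => cons_measure m (tuple_measure m k)
  end.

Lemma tuple_measure_box (m : {sigma_finite_measure set T -> \bar R})
    (n : nat) (A : 'I_n -> set T) :
  (forall i, measurable (A i)) ->
  tuple_measure m n [set t | forall i, A i (tnth t i)] =
  (\prod_(i < n) m (A i))%E.
Proof.
elim: n A => [|n IH] A mA.
  rewrite big_ord0 /= diracE mem_set//=; by case.
rewrite big_ord_recl -IH //= /cons_measure /pushforward.
rewrite (_ : _ @^-1` _ =
  A ord0 `*` [set t : n.-tuple T | forall i, A (lift ord0 i) (tnth t i)]).
  rewrite product_measure1E//.
  rewrite (_ : [set t | _] = \bigcap_(i : 'I_n)
     ((fun t : n.-tuple T => tnth t i) @^-1` (A (lift ord0 i)))).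
    apply: fin_bigcap_measurable => // i _.
    by rewrite -[X in measurable X]setTI; exact: measurable_tnth.
  by apply/seteqP; split => [t /= h i _|t /= h i]; exact: h.
apply/seteqP; split => [[x t] /= h|[x t] /= [h0 h] i].
  split; first exact: (h ord0).
  by move=> i; have := h (lift ord0 i); rewrite tnthS.
have [->//|i0] := eqVneq i ord0.
have [j ->] : exists j, i = lift ord0 j.
  by case: (unliftP ord0 i) i0 => [j -> _|->]; [exists j | rewrite eqxx].
by rewrite tnthS; exact: h.
Qed.

End TupleMeasure.

(* n.-tuple T carries the product sigma-algebra, so this is the d-dimensional
   Lebesgue measure on Borel sets, transported along the identification of
   tuples with row vectors; off the Borel sets the value is not meaningful. *)
Definition vol (R : realType) (d : nat) (A : set 'rV[R]_d) : \bar R :=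
  tuple_measure (@lebesgue_measure R) d
    [set t : d.-tuple (measurableTypeR R) | A (\row_i tnth t i)].

Section Ellipsoids.
Context {R : realType}.

(* Exponents live in \bar R. The value at -oo is junk: exponents are always
   assumed to be at least 1. *)
Definition lpnorm (d : nat) (p : \bar R) (x : 'rV[R]_d) : R :=
  match p with
  | r%:E%E => (\sum_(i < d) `|x 0 i| `^ r) `^ r^-1
  | +oo%E => \big[Num.max/0]_(i < d) `|x 0 i|
  | -oo%E => 0
  end.

Definition lpball (d : nat) (p : \bar R) : set 'rV[R]_d :=
  [set x | lpnorm p x <= 1].

Definition wlpnorm (d : nat) (p : \bar R) (mu x : 'rV[R]_d) : R :=
  lpnorm p (\row_i (x 0 i / mu 0 i)).

Definition ellipsoid (d : nat) (p : \bar R) (mu : 'rV[R]_d) : set 'rV[R]_d :=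
  [set x | wlpnorm p mu x <= 1].

Definition semi_axes (d : nat) (mu : 'rV[R]_d) : Prop :=
  (forall i, 0 < mu 0 i) /\
  (forall i j : 'I_d, (i <= j)%N -> mu 0 j <= mu 0 i).

Definition geomean (d : nat) (mu : 'rV[R]_d) : R :=
  (\prod_(i < d) mu 0 i) `^ d%:R^-1.

Definition is_cover (d : nat) (eps : R) (K : set 'rV[R]_d) (q : \bar R)
    (X : {fset 'rV[R]_d}) : Prop :=
  forall x, K x -> exists2 c, c \in X & lpnorm q (x - c) <= eps.

(* The infimum is attained as soon as a finite cover exists, and is +oo
   otherwise. *)
Definition covering_number (d : nat) (eps : R) (K : set 'rV[R]_d)
    (q : \bar R) : \bar R :=
  ereal_inf [set (#|` X|%:R)%:E | X in is_cover eps K q].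

(* 1/p for p in [1, +oo]; the inverse of extended reals satisfies
   +oo^-1 = 0. *)
Definition inv_exp (p : \bar R) : R := fine (p^-1)%E.

Definition Vratio (p q : \bar R) (d : nat) : R :=
  (fine (vol (@lpball d p)) / fine (vol (@lpball d q))) `^ d%:R^-1.

Definition log2 (x : R) : R := ln x / ln 2.

End Ellipsoids.

(* Main.v *)
(** The lower bound compares volumes. For the upper bound, let [d] be the
    dimension, [L] a maximal [delta eps]-separated subset of the ellipsoid [E],
    with [delta = 1/(2d)], and [rho = vol((1+eta)E) / vol(eps B_q)]. The
    hypothesis on [eps] says that [eps B_q] is contained in [eta E], so all balls
    considered lie in [(1+eta)E]; disjointness of the half-size balls gives
    [#L <= (4d)^d rho]. Averaging over [(1+eta)E], some point is within
    [(1-delta) eps] of a proportion at least [(1-delta)^d / rho >= 1/(2 rho)] of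
    any subset of [L]. Choosing such points greedily about [2 rho d ln(4d)] times
    leaves at most [rho] points of [L] uncovered, and each of these becomes a
    center itself. Hence [N - 1 <= 9 d^2 rho], and [kappa(d) = (9 d^2)^(1/d)]. *)

Require Import Defs.
From mathcomp Require Import all_boot all_order all_algebra finmap.
From mathcomp Require Import all_classical all_reals all_analysis.
From mathcomp Require Import measurable_realfun.
From mathcomp Require Import ring lra.

Set Implicit Arguments.
Unset Strict Implicit.
Unset Printing Implicit Defensive.

Import Order.TTheory GRing.Theory Num.Theory.
Import numFieldNormedType.Exports.

Local Open Scope classical_set_scope.
Local Open Scope ring_scope.

(** * The [l^p] norms: homogeneity, triangle inequality, monotonicity in the exponent *)

Section Lpnorm.
Context {R : realType}.
Implicit Types (p q : \bar R) (r a b : R).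

Lemma exp_cases (P : \bar R -> Prop) :
  (forall r, 1 <= r -> P r%:E) -> P +oo%E -> forall p, (1 <= p)%E -> P p.
Proof. by move=> Pr Poo [r| |]//; rewrite lee_fin; exact: Pr. Qed.

Lemma powR_le_invr r a b : 0 < r -> 0 <= a -> 0 <= b ->
  (a `^ r^-1 <= b) = (a <= b `^ r).
Proof.
move=> r0 a0 b0.
have {2}-> : a = (a `^ r^-1) `^ r by rewrite -powRrM mulVf ?gt_eqF// powRr1.
apply/idP/idP => [|h].
  by apply: ge0_ler_powR; rewrite ?nnegrE ?powR_ge0// ltW.
rewrite leNgt; apply/negP => h'; move: h; apply/negP; rewrite -ltNge.
by apply: gt0_ltr_powR; rewrite ?nnegrE ?powR_ge0.
Qed.

Lemma powRVK r a : 0 < r -> 0 <= a -> (a `^ r^-1) `^ r = a.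
Proof. by move=> r0 a0; rewrite -powRrM mulVf ?gt_eqF// powRr1. Qed.

Lemma powRKV r a : 0 < r -> 0 <= a -> (a `^ r) `^ r^-1 = a.
Proof. by move=> r0 a0; rewrite -powRrM mulfV ?gt_eqF// powRr1. Qed.

Variable d : nat.
Implicit Types x y : 'rV[R]_d.

Lemma sum_powR_ge0 r x : 0 <= \sum_(i < d) `|x 0 i| `^ r.
Proof. by apply: sumr_ge0 => i _; exact: powR_ge0. Qed.

Lemma lpnorm_ge0 p x : 0 <= lpnorm p x.
Proof.
case: p => [r| |]//=; first exact: powR_ge0.
by elim/big_ind : _ => // a b a0 b0; rewrite le_max a0.
Qed.

Lemma lpnorm_finP x r b : 1 <= r -> 0 <= b ->
  reflect (\sum_(i < d) `|x 0 i| `^ r <= b `^ r) (lpnorm r%:E x <= b).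
Proof.
move=> r1 b0; rewrite /= powR_le_invr ?sum_powR_ge0//; first exact: idP.
exact: lt_le_trans r1.
Qed.

Lemma lpnorm_fin_powR r x : 1 <= r ->
  (lpnorm r%:E x) `^ r = \sum_(i < d) `|x 0 i| `^ r.
Proof.
by move=> r1; rewrite /= powRVK ?sum_powR_ge0// (lt_le_trans ltr01).
Qed.

Lemma lpnorm_ooP x b : 0 <= b ->
  reflect (forall i, `|x 0 i| <= b) (lpnorm +oo%E x <= b).
Proof.
move=> b0; apply: (iffP idP) => /= [h i|h].
  exact: le_trans (le_bigmax _ (fun i => `|x 0 i|) i) h.
exact: bigmax_le.
Qed.

(** One inequality is enough for homogeneity: used again with [a^-1] at the vector [a *: x], it
    yields the reverse one. *)
Lemma lpnorm_scale_le p a x b : (1 <= p)%E -> 0 <= b ->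
  lpnorm p x <= b -> lpnorm p (a *: x) <= `|a| * b.
Proof.
move=> + b0; move: p; apply: exp_cases => [r r1|].
  move=> /(lpnorm_finP _ r1 b0) h; apply/lpnorm_finP; rewrite ?mulr_ge0//.
  rewrite powRM//; under eq_bigr do rewrite mxE normrM powRM//.
  by rewrite -mulr_sumr ler_wpM2l ?powR_ge0.
move=> /lpnorm_ooP-/(_ b0) h; apply/lpnorm_ooP; rewrite ?mulr_ge0// => i.
by rewrite mxE normrM ler_wpM2l.
Qed.

Lemma lpnormZ p a x : (1 <= p)%E -> lpnorm p (a *: x) = `|a| * lpnorm p x.
Proof.
move=> p1; apply/eqP; rewrite eq_le lpnorm_scale_le ?lpnorm_ge0//=.
have [->|a0] := eqVneq a 0; first by rewrite normr0 mul0r lpnorm_ge0.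
rewrite -ler_pdivlMl ?normr_gt0// -normfV.
have {1}-> : x = a^-1 *: (a *: x) by rewrite scalerA mulVf// scale1r.
by rewrite lpnorm_scale_le ?lpnorm_ge0.
Qed.

Lemma lpnormN p x : (1 <= p)%E -> lpnorm p (- x) = lpnorm p x.
Proof. by move=> p1; rewrite -scaleN1r lpnormZ// normrN1 mul1r. Qed.

Lemma lpnorm0 p : (1 <= p)%E -> lpnorm p (0 : 'rV[R]_d) = 0.
Proof. by move=> p1; rewrite -(scale0r 0) lpnormZ// normr0 mul0r. Qed.

(** Convexity of the [r]-th power: (u + v)/(a + b) is the average of u/a and v/b with weights
    proportional to [a] and [b]. *)
Lemma powR_convex_sum r a b u v : 1 <= r -> 0 < a -> 0 < b -> 0 <= u -> 0 <= v ->
  ((u + v) / (a + b)) `^ r <=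
  a / (a + b) * (u / a) `^ r + b / (a + b) * (v / b) `^ r.
Proof.
move=> r1 a0 b0 u0 v0; have ab0 : 0 < a + b by exact: addr_gt0.
have t0 : 0 <= b / (a + b) by rewrite divr_ge0 ?ltW.
have t1 : b / (a + b) <= 1 by rewrite ler_pdivrMr// mul1r lerDr ltW.
have := @convex_powR R r r1 (Itv01 t0 t1) (v / b) (u / a).
rewrite !inE /= !in_itv /= !andbT.
move=> /(_ (divr_ge0 v0 (ltW b0)) (divr_ge0 u0 (ltW a0))) h.
have -> : (u + v) / (a + b) = b / (a + b) * (v / b) + (1 - b / (a + b)) * (u / a).
  by field; rewrite !gt_eqF.
rewrite [leRHS]addrC.
have -> : a / (a + b) = 1 - b / (a + b) by field; rewrite gt_eqF.
exact: h.
Qed.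

(* Minkowski's inequality is the convexity of the unit ball, rescaled; working
   with positive upper bounds a, b of the two norms avoids dividing by 0. *)
Lemma lpnormD_le p x y a b : (1 <= p)%E -> 0 < a -> 0 < b ->
  lpnorm p x <= a -> lpnorm p y <= b -> lpnorm p (x + y) <= a + b.
Proof.
move=> + a0 b0; have ab0 : 0 < a + b by exact: addr_gt0.
move: p; apply: exp_cases => [r r1|].
  have r0 : 0 < r by exact: lt_le_trans r1.
  move=> /(lpnorm_finP _ r1 (ltW a0)) xa /(lpnorm_finP _ r1 (ltW b0)) yb.
  apply/lpnorm_finP; rewrite ?(ltW ab0)//.
  have nrm c (z : 'rV_d) : 0 < c ->
      \sum_(i < d) `|z 0 i| `^ r <= c `^ r -> \sum_(i < d) (`|z 0 i| / c) `^ r <= 1.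
    move=> c0 zc; under eq_bigr do rewrite powRM ?invr_ge0 ?(ltW c0)//.
    rewrite -mulr_suml -powR_inv1 ?(ltW c0)// powRAC powR_inv1 ?powR_ge0//.
    by rewrite ler_pdivrMr ?powR_gt0// mul1r.
  suff : \sum_(i < d) ((`|x 0 i| + `|y 0 i|) / (a + b)) `^ r <= 1.
    under eq_bigr do rewrite powRM ?addr_ge0// ?invr_ge0 ?(ltW ab0)//.
    rewrite -mulr_suml -powR_inv1 ?(ltW ab0)// powRAC powR_inv1 ?powR_ge0//.
    rewrite ler_pdivrMr ?powR_gt0// mul1r; apply: le_trans.
    apply: ler_sum => i _; rewrite mxE; apply: ge0_ler_powR;
      by rewrite ?nnegrE ?addr_ge0 ?ler_normD ?(ltW r0).
  apply: (@le_trans _ _ (\sum_(i < d) (a / (a + b) * (`|x 0 i| / a) `^ r +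
     b / (a + b) * (`|y 0 i| / b) `^ r))).
    by apply: ler_sum => i _; exact: powR_convex_sum.
  rewrite big_split/= -!mulr_sumr.
  have -> : 1 = a / (a + b) * 1 + b / (a + b) * 1 by field; rewrite gt_eqF.
  by apply: lerD; apply: ler_wpM2l; rewrite ?divr_ge0 ?nrm ?(ltW a0) ?(ltW b0) ?(ltW ab0).
move=> /lpnorm_ooP-/(_ (ltW a0)) xa /lpnorm_ooP-/(_ (ltW b0)) yb.
apply/lpnorm_ooP; rewrite ?(ltW ab0)// => i; rewrite mxE.
by rewrite (le_trans (ler_normD _ _))// lerD.
Qed.

Lemma lpnormD p x y : (1 <= p)%E -> lpnorm p (x + y) <= lpnorm p x + lpnorm p y.
Proof.
(* A norm may vanish, while [lpnormD_le] asks for positive bounds; each norm is enlarged by e/2. *)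
move=> p1; apply/ler_addgt0Pr => e e0.
have -> : lpnorm p x + lpnorm p y + e = (lpnorm p x + e / 2) + (lpnorm p y + e / 2).
  by field.
have e20 : 0 < e / 2 by rewrite divr_gt0.
by apply: lpnormD_le; rewrite ?ltr_wpDl ?lpnorm_ge0// lerDl ltW.
Qed.

Lemma normr_le_lpnorm p x i : (1 <= p)%E -> `|x 0 i| <= lpnorm p x.
Proof.
move: p; apply: exp_cases => [s s1|].
  have s0 : 0 < s by exact: lt_le_trans s1.
  rewrite -(@powRKV s `|x 0 i|)//=.
  rewrite ge0_ler_powR ?nnegrE ?powR_ge0 ?invr_ge0 ?(ltW s0) ?sum_powR_ge0//.
  by rewrite (bigD1 i)//= lerDl sumr_ge0// => j _; exact: powR_ge0.
by move: i; apply/lpnorm_ooP => //; exact: lpnorm_ge0.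
Qed.

(** Let M be the [s]-norm of [x]. Every coordinate is at most M in absolute value, so |x_i|^r <=
    |x_i|^s M^(r-s), and summation gives M^r. *)
Lemma lpnorm_fin_mono r s x : 1 <= s -> s <= r -> lpnorm r%:E x <= lpnorm s%:E x.
Proof.
move=> s1 sr; have r1 := le_trans s1 sr.
have s0 : 0 < s by exact: lt_le_trans s1.
apply/lpnorm_finP; rewrite ?lpnorm_ge0//.
have rE : r = s + (r - s) by rewrite [RHS]addrC subrK.
have pD (a : R) : a `^ r = a `^ s * a `^ (r - s).
  by rewrite -powRD -rE// gt_eqF// (lt_le_trans s0).
rewrite pD lpnorm_fin_powR// mulr_suml; apply: ler_sum => i _.
rewrite pD ler_wpM2l ?powR_ge0//; apply: ge0_ler_powR.
- by rewrite subr_ge0.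
- by rewrite nnegrE.
- by rewrite nnegrE lpnorm_ge0.
exact: (normr_le_lpnorm (p := s%:E)).
Qed.

End Lpnorm.

(** * Comparison of two [l^p] norms, with the dimensional factor *)

Section LpnormComparison.
Context {R : realType}.
Implicit Types (p q : \bar R) (r s t : R).

Lemma inv_expE r : 0 < r -> inv_exp r%:E = r^-1.
Proof. by move=> r0; rewrite /inv_exp inver gt_eqF. Qed.

Lemma inv_expy : inv_exp (+oo%E : \bar R) = 0.
Proof. by rewrite /inv_exp invey. Qed.

Variable d : nat.

(* Young's inequality [v <= v^t / t + (1 - 1/t)], summed over the terms
   normalized by their power mean. *)
Lemma power_mean_le t (u : 'I_d.+1 -> R) : 1 < t -> (forall i, 0 <= u i) ->
  \sum_i u i <= d.+1%:R * ((\sum_i u i `^ t) / d.+1%:R) `^ t^-1.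
Proof.
move=> t1 u0; have t0 : 0 < t by exact: lt_trans t1.
set S := \sum_i u i `^ t; have S0 : 0 <= S by apply: sumr_ge0 => i _; exact: powR_ge0.
set m := (S / d.+1%:R) `^ t^-1; have m0 : 0 <= m by exact: powR_ge0.
have dm : m `^ t = S / d.+1%:R by rewrite powRVK// divr_ge0.
have [mz|mn0] := eqVneq m 0.
  have Sz : S = 0.
    have := dm; rewrite mz powR0 ?gt_eqF// => /esym/eqP.
    by rewrite mulf_eq0 invr_eq0 pnatr_eq0 orbF => /eqP.
  rewrite mz mulr0 big1// => i _.
  have /eqP : u i `^ t = 0.
    apply/le_anti/andP; split; last exact: powR_ge0.
    rewrite -Sz /S (bigD1 i)//= lerDl.
    by apply: sumr_ge0 => j _; exact: powR_ge0.
  by rewrite powR_eq0 (gt_eqF t0) andbT => /eqP.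
have mp : 0 < m by rewrite lt_def mn0.
rewrite -ler_pdivrMr// mulr_suml.
pose t' := (1 - t^-1)^-1.
have ti1 : t^-1 < 1 by rewrite invf_lt1.
have t'0 : 0 < t' by rewrite invr_gt0 subr_gt0.
have tt' : t^-1 + t'^-1 = 1 by rewrite invrK addrC subrK.
apply: (@le_trans _ _ (\sum_i ((u i / m) `^ t / t + t'^-1))).
  apply: ler_sum => i _.
  have := @conjugate_powR R (u i / m) 1 t t' (divr_ge0 (u0 i) m0) ler01 t0 t'0 tt'.
  by rewrite mulr1 powR1 mul1r.
rewrite big_split/= -mulr_suml sumr_const card_ord -[t'^-1 *+ _]mulr_natl.
have -> : \sum_i (u i / m) `^ t = d.+1%:R.
  under eq_bigr do rewrite powRM ?invr_ge0// -(powR_inv1 m0) powRAC.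
  rewrite -mulr_suml -/S powR_inv1 ?powR_ge0// dm invf_div mulrCA divff ?mulr1//.
  apply/eqP => Sz; move: mp; rewrite /m Sz mul0r powR0 ?ltxx//.
  by rewrite invr_eq0 gt_eqF.
by rewrite -mulrDr tt' mulr1.
Qed.

(** The power mean inequality for the numbers |x_i|^r with exponent s/r > 1. *)
Lemma lpnorm_fin_le r s (x : 'rV[R]_d.+1) : 1 <= r -> r < s ->
  lpnorm r%:E x <= d.+1%:R `^ (r^-1 - s^-1) * lpnorm s%:E x.
Proof.
move=> r1 rs; have r0 : 0 < r by exact: lt_le_trans r1.
have s0 : 0 < s by exact: lt_trans rs.
have D0 : (0 : R) < d.+1%:R by rewrite ltr0n.
have -> : d.+1%:R `^ (r^-1 - s^-1) = d.+1%:R `^ r^-1 / d.+1%:R `^ s^-1 :> R.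
  by rewrite powRB// (gt_eqF D0) implybT.
rewrite /= powR_le_invr ?sum_powR_ge0//; last first.
  by rewrite mulr_ge0 ?divr_ge0 ?powR_ge0.
have ts1 : 1 < s / r by rewrite ltr_pdivlMr// mul1r.
have := @power_mean_le (s / r) (fun i => `|x 0 i| `^ r) ts1 (fun i => powR_ge0 _ _).
move=> /le_trans; apply; rewrite invf_div.
have -> : \sum_i (`|x 0 i| `^ r) `^ (s / r) = \sum_i `|x 0 i| `^ s.
  by apply: eq_bigr => i _; rewrite -powRrM mulrCA divff ?gt_eqF// mulr1.
set S := \sum_i _; have S0 : 0 <= S by apply: sumr_ge0 => i _; exact: powR_ge0.
rewrite -mulrA [leRHS]powRM ?powR_ge0 ?mulr_ge0 ?invr_ge0 ?powR_ge0// powRVK ?(ltW D0)//.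
rewrite ler_wpM2l ?(ltW D0)//.
rewrite [r / s]mulrC powRrM [X in _ <= X `^ _](_ : _ = (S / d.+1%:R) `^ s^-1)//.
rewrite mulrC powRM ?invr_ge0 ?(ltW D0)//; congr (_ * _).
by rewrite -(powR_inv1 (ltW D0)) powRAC powR_inv1 ?powR_ge0.
Qed.

Lemma lpnorm_fin_le_oo r (x : 'rV[R]_d.+1) : 1 <= r ->
  lpnorm r%:E x <= d.+1%:R `^ r^-1 * lpnorm +oo%E x.
Proof.
move=> r1; have r0 : 0 < r by exact: lt_le_trans r1.
apply/lpnorm_finP => //; first by rewrite mulr_ge0 ?powR_ge0 ?lpnorm_ge0.
rewrite powRM ?powR_ge0 ?lpnorm_ge0// powRVK ?ler0n//.
rewrite mulr_natl -[X in _ *+ X](card_ord d.+1) -sumr_const; apply: ler_sum => i _.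
apply: ge0_ler_powR; rewrite ?nnegrE ?lpnorm_ge0 ?(ltW r0)//.
by rewrite (normr_le_lpnorm (p := +oo%E)) ?leey.
Qed.

(** The positive part joins two regimes: for p < q the power mean inequality costs a power of the
    dimension, and for p >= q monotonicity in the exponent costs nothing. *)
Lemma lpnorm_le p q (x : 'rV[R]_d.+1) : (1 <= p)%E -> (1 <= q)%E ->
  lpnorm p x <= d.+1%:R `^ (Num.max (inv_exp p - inv_exp q) 0) * lpnorm q x.
Proof.
move=> + q1; move: p; apply: exp_cases => [r r1|]; last first.
  rewrite inv_expy add0r max_r; last first.
    rewrite oppr_le0; move: q q1; apply: exp_cases => [s s1|].
      by rewrite inv_expE ?invr_ge0 ?(le_trans ler01)// (lt_le_trans ltr01).
    by rewrite inv_expy.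
  rewrite powRr0 mul1r; apply/lpnorm_ooP => [|i]; first exact: lpnorm_ge0.
  exact: normr_le_lpnorm.
have r0 : 0 < r by exact: lt_le_trans r1.
rewrite inv_expE//; move: q q1; apply: exp_cases => [s s1|]; last first.
  by rewrite inv_expy subr0 max_l ?invr_ge0 ?(ltW r0)// lpnorm_fin_le_oo.
have s0 : 0 < s by exact: lt_le_trans s1.
rewrite inv_expE//; have [rs|sr] := ltP r s.
  by rewrite max_l ?lpnorm_fin_le// subr_ge0 lef_pV2 ?posrE// ltW.
by rewrite max_r ?powRr0 ?mul1r ?lpnorm_fin_mono// subr_le0 lef_pV2 ?posrE.
Qed.

Lemma le_inv_exp p q : (1 <= q)%E -> (q <= p)%E -> inv_exp p <= inv_exp q.
Proof.
move=> q1 qp; have p1 := le_trans q1 qp; move: p p1 qp.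
apply: exp_cases => [r r1|_].
  move: q q1; apply: exp_cases => [s s1|]; last by rewrite leNgt ltry.
  have s0 : 0 < s by exact: lt_le_trans s1.
  rewrite lee_fin => sr; have r0 : 0 < r by exact: lt_le_trans sr.
  by rewrite !inv_expE// lef_pV2 ?posrE.
rewrite inv_expy; move: q q1; apply: exp_cases => [s s1|]; last by rewrite inv_expy.
by rewrite inv_expE ?invr_ge0 ?(le_trans ler01)// (lt_le_trans ltr01).
Qed.

End LpnormComparison.

(** * Change of variables for maps acting coordinate by coordinate *)

Lemma measurable_preimageT d d' (T : measurableType d) (T' : measurableType d') (f : T -> T') A :
  measurable_fun setT f -> measurable A -> measurable (f @^-1` A).
Proof. by move=> mf mA; rewrite -[X in measurable X]setTI; exact: mf. Qed.

Section PushforwardMeasure.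
Local Open Scope ereal_scope.
Context d1 d2 (T1 : measurableType d1) (T2 : measurableType d2) (R : realType).

(** Bundles the pushforward with its measure structure, so that it can be rescaled and passed to the
    uniqueness theorems for measures. *)
Definition push (m : {measure set T1 -> \bar R}) (f : T1 -> T2)
    (mf : measurable_fun setT f) : {measure set T2 -> \bar R} :=
  measure_function_pushforward__canonical__measure_function_Measure m mf.

End PushforwardMeasure.

Section ScaledPreimage.
Local Open Scope ereal_scope.
Context d (T : measurableType d) (R : realType).

Definition tuple_fun n (f : 'I_n -> T -> T) (t : n.-tuple T) : n.-tuple T :=
  [tuple f i (tnth t i) | i < n].

Lemma measurable_tuple_fun n (f : 'I_n -> T -> T) :
  (forall i, measurable_fun setT (f i)) -> measurable_fun setT (tuple_fun f).
Proof.
move=> mf; apply/measurable_fun_tnthP => i.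
rewrite (_ : _ \o _ = f i \o (@tnth n T ^~ i)); last first.
  by apply/funext => t /=; rewrite tnth_mktuple.
by apply: measurableT_comp => //; exact: measurable_tnth.
Qed.

Variable m : {sigma_finite_measure set T -> \bar R}.

(** By induction on [n], splitting off the first coordinate: once divided by the product of the
    factors, the pushforward agrees with the product measure on rectangles, hence everywhere. *)
Lemma tuple_measure_preimage n (f : 'I_n -> T -> T) (k : 'I_n -> R) :
  (forall i, measurable_fun setT (f i)) -> (forall i, (0 < k i)%R) ->
  (forall i A, measurable A -> m (f i @^-1` A) = (k i)%:E * m A) ->
  forall A, measurable A ->
  tuple_measure m n (tuple_fun f @^-1` A) =
  (\prod_(i < n) k i)%:E * tuple_measure m n A.
Proof.
elim: n f k => [|n IH] f k mf k0 fk A mA.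
  rewrite big_ord0 mul1e /= !diracE.
  have -> // : tuple_fun f @^-1` A = A.
  by apply/seteqP; split => t /=; rewrite (tuple0 (tuple_fun f t)) (tuple0 t).
pose g i := f (lift ord0 i); pose k' i := k (lift ord0 i).
have mg i : measurable_fun setT (g i) by exact: mf.
pose F (z : T * n.-tuple T) := (f ord0 z.1, tuple_fun g z.2).
have mF : measurable_fun setT F.
  apply: measurable_fun_pair; first exact: measurableT_comp (mf _) measurable_fst.
  exact: measurableT_comp (measurable_tuple_fun mg) measurable_snd.
have kp : (0 < \prod_(i < n.+1) k i)%R by apply: prodr_gt0.
pose c : {nonneg R} := NngNum (ltW (divr_gt0 ltr01 kp)).
pose C := @consT _ T n @^-1` A.
have mC : measurable C by exact: measurable_preimageT (@measurable_consT _ T n) mA.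
(* Through [consT], the map on tuples becomes the product map [F] on pairs. *)
have FE z : tuple_fun f (consT z) = consT (F z).
  apply: eq_from_tnth => i; rewrite tnth_mktuple.
  by case: (unliftP ord0 i) => [j ->|->]; rewrite ?tnthS ?tnth_mktuple.
have := @product_measure_unique _ _ _ _ _ m (tuple_measure m n)
  (mscale c (push (m \x tuple_measure m n) mF)).
move=> /(_ _ C mC) uniq_m; rewrite /= /cons_measure /pushforward -/C uniq_m /=.
  rewrite /mscale /= /pushforward mul1r muleA -EFinM divff ?gt_eqF// mul1e.
  by congr ((m \x _) _); apply/seteqP; split => z /=; rewrite FE.
move=> X Y mX mY.
rewrite /mscale /= /pushforward (_ : F @^-1` _ = (f ord0 @^-1` X) `*` (tuple_fun g @^-1` Y))//.
rewrite product_measure1E//; last 2 first.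
  exact: measurable_preimageT.
  by apply: measurable_preimageT => //; exact: measurable_tuple_fun.
transitivity ((1 / \prod_(i < n.+1) k i)%:E * (((k ord0)%:E * m X) *
    ((\prod_i k' i)%:E * tuple_measure m n Y))).
  congr (_ * (_ * _)); first exact: fk.
  by apply: IH => // [i|i B mB]; [exact: k0|exact: fk].
rewrite muleACA -EFinM !muleA -EFinM big_ord_recl div1r mulVf ?mul1e//.
by have := kp; rewrite big_ord_recl => /lt0r_neq0.
Qed.

End ScaledPreimage.

(** Lebesgue measure is determined by its values on half-open intervals, and the preimage of ]a, b]
    is ]sa + c, sb + c]. *)
Lemma lebesgue_measure_affine (R : realType) (c s : R)
    (A : set (measurableTypeR R)) : 0 < s -> measurable A ->
  lebesgue_measure ((fun x : measurableTypeR R => (x - c) / s) @^-1` A) =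
  (s%:E * lebesgue_measure A)%E.
Proof.
move=> s0 mA.
have mf : measurable_fun setT (fun x : measurableTypeR R => (x - c) / s : measurableTypeR R).
  by apply: measurable_funM => //; exact: measurable_funB.
have si0 : 0 <= s^-1 by rewrite invr_ge0 ltW.
rewrite [in RHS](@lebesgue_measure_unique _ (mscale (NngNum si0) (push lebesgue_measure mf)))//.
  by rewrite /= /mscale /= muleA -EFinM divff ?gt_eqF// mul1e.
move=> _ [[a b]] _ <-; rewrite /= /mscale /= /pushforward.
rewrite (_ : _ @^-1` _ = `](s * a + c)%R, (s * b + c)%R]%classic).
  rewrite !lebesgue_measure_itv/= !lte_fin ltrD2r ltr_pM2l//.
  case: ifP => _; last by rewrite mule0.
  by rewrite -!EFinB -EFinM; congr (_%:E); field; rewrite gt_eqF.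
apply/seteqP; split => x /=; rewrite !in_itv/= ltr_pdivlMr// ler_pdivrMr//
  ltrBrDr lerBlDr ![s * _]mulrC//.
Qed.

(** * Double counting and greedy selection for a finite family of sets *)

Section Greedy.
Local Open Scope ereal_scope.
Context d (T : measurableType d) (R : realType).
Variable mu : {measure set T -> \bar R}.
Variables (I : eqType) (B : I -> set T) (A : set T).
Hypotheses (mA : measurable A) (mB : forall c, measurable (B c)).

Definition hits (x : T) : pred I := fun c => x \in B c.

Lemma count_indic x (L : seq I) :
  \sum_(c <- L) (\1_(B c) x)%:E = (count (hits x) L)%:R%:E :> \bar R.
Proof.
elim: L => [|c L IH]; first by rewrite big_nil.
by rewrite big_cons IH /= natrD EFinD indicE.
Qed.

Lemma integral_count D (L : seq I) : measurable D ->
  \int[mu]_(x in D) (count (hits x) L)%:R%:E = \sum_(c <- L) mu (B c `&` D).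
Proof.
move=> mD; under eq_integral do rewrite -count_indic.
rewrite ge0_integral_sum//; first by apply: eq_bigr => c _; rewrite integral_indic.
by move=> c; apply/measurable_EFinP/measurable_indic.
Qed.

Lemma measurable_count D (L : seq I) :
  measurable_fun D (fun x => (count (hits x) L)%:R%:E : \bar R).
Proof.
rewrite (_ : (fun _ => _) = fun x => \sum_(c <- L) (\1_(B c) x)%:E).
  by apply: emeasurable_sum => c; apply/measurable_EFinP/measurable_indic.
by apply/funext => x; rewrite count_indic.
Qed.

(** Integrate over [A] the number of sets [B c] containing a point. With k = 1 this is the packing
    bound for disjoint sets. *)
Lemma sum_measure_le_mult (k : nat) (L : seq I) :
  {in L, forall c, B c `<=` A} ->
  (forall x, A x -> (count (hits x) L <= k)%N) ->
  \sum_(c <- L) mu (B c) <= k%:R%:E * mu A.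
Proof.
move=> BA Lk.
have -> : \sum_(c <- L) mu (B c) = \sum_(c <- L) mu (B c `&` A).
  by apply: eq_big_seq => c cL; rewrite (setIidl (BA c cL)).
rewrite -integral_count// -integral_cst//.
apply: ge0_le_integral => //.
- exact: measurable_count.
- by move=> x Ax; rewrite lee_fin ler_nat Lk.
Qed.

Lemma measure_le_sum_cover (L : seq I) :
  (forall x, A x -> (0 < count (hits x) L)%N) -> mu A <= \sum_(c <- L) mu (B c).
Proof.
move=> AL; apply: (@le_trans _ _ (\sum_(c <- L) mu (B c `&` A))).
  rewrite -integral_count// -[leLHS]mul1e -integral_cst//.
  apply: ge0_le_integral => //.
  - exact: measurable_count.
  - by move=> x Ax; rewrite lee_fin ler1n AL.
by apply: lee_sum => c _; rewrite le_measure ?inE//; exact: measurableI.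
Qed.

Variables (v a : R).
Hypotheses (v0 : (0 < v)%R)
  (muB : forall c, mu (B c) = v%:E) (muA : mu A = a%:E).

Lemma sum_measure_const (L : seq I) : \sum_(c <- L) mu (B c) = ((size L)%:R * v)%:E.
Proof.
elim: L => [|c L IH]; first by rewrite big_nil mul0r.
by rewrite big_cons IH muB -EFinD /= -[in RHS]natr1 mulrDl mul1r addrC.
Qed.

(** Some point does at least as well as the average over [A] of the number of sets containing it. *)
Lemma heavy_point (L : seq I) : {in L, forall c, B c `<=` A} -> (0 < size L)%N ->
  exists2 x, A x & ((size L)%:R * v <= (count (hits x) L)%:R * a)%R.
Proof.
case: L => // c0 L0; set L := c0 :: L0 => BA _.
have [x0 Ax0] : A !=set0.
  apply/set0P/eqP => A0; have := muB c0.
  have -> : B c0 = set0 by apply/seteqP; split => // y /(BA _ (mem_head _ _)); rewrite A0.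
  by rewrite measure0 => -[] /esym v00; move: v0; rewrite v00 ltxx.
(* The counts are bounded by [size L], so the largest is attained; as a uniform bound on the
   multiplicity it enters [sum_measure_le_mult]. *)
pose P k := `[< exists2 x, A x & count (hits x) L = k >].
have exP : exists k, P k by exists (count (hits x0) L); apply/asboolP; exists x0.
have bP k : P k -> (k <= size L)%N by move=> /asboolP[x _ <-]; exact: count_size.
case: (ex_maxnP exP bP) => k /asboolP[x Ax xk] maxk; exists x => //.
rewrite -lee_fin -sum_measure_const EFinM -muA; apply: sum_measure_le_mult => //.
by move=> y Ay; rewrite xk; apply: maxk; apply/asboolP; exists y.
Qed.

(** Picking a heavy point leaves at most a fraction 1 - v/a <= exp(-v/a) of the list unhit; this is
    repeated [m] times on what remains. *)
Lemma greedy_cover (m : nat) (L : seq I) : {in L, forall c, B c `<=` A} ->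
  exists2 X : seq T, (size X <= m)%N &
  ((count (fun c => ~~ has (fun x => hits x c) X) L)%:R <=
   (size L)%:R * expR (- (m%:R * (v / a))))%R.
Proof.
have [/size0nil ->|L0 BA] := posnP (size L).
  by move=> _; exists [::] => //=; rewrite mul0r.
(* Division by [a] needs a > 0, which a heavy point of the nonempty list forces. *)
have a0 : (0 < a)%R.
  have [x Ax h] := heavy_point BA L0; rewrite ltNge; apply/negP => a0.
  have : (0 < (size L)%:R * v)%R by rewrite mulr_gt0// ltr0n.
  by rewrite ltNge (le_trans h)// mulr_ge0_le0.
elim: m L {L0} BA => [|m IH] L BA.
  by exists [::] => //=; rewrite mul0r oppr0 expR0 mulr1 ler_nat count_size.
have [/size0nil ->|L0] := posnP (size L); first by exists [::] => //=; rewrite mul0r.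
have [x Ax hx] := heavy_point BA L0.
pose L' := [seq c <- L | ~~ hits x c].
have BA' : {in L', forall c, B c `<=` A}.
  by move=> c; rewrite mem_filter => /andP[_]; exact: BA.
have [X sX hX] := IH L' BA'; exists (x :: X) => //=.
rewrite (_ : count _ L = count (fun c => ~~ has (fun x => hits x c) X) L'); last first.
  by rewrite count_filter; apply: eq_count => c /=; rewrite negb_or andbC.
apply: (le_trans hX).
have sL' : ((size L')%:R = (size L)%:R - (count (hits x) L)%:R :> R)%R.
  by rewrite size_filter -(count_predC (hits x) L) natrD addrAC subrr add0r.
have -> : (- (m.+1%:R * (v / a)) = - (v / a) + - (m%:R * (v / a)))%R.
  by rewrite -opprD -[m.+1]add1n natrD mulrDl mul1r.
rewrite expRD [leRHS]mulrA ler_wpM2r ?expR_ge0//.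
rewrite sL' (@le_trans _ _ ((size L)%:R * (1 - v / a))%R)//.
  by rewrite mulrBr mulr1 lerD2l lerN2 mulrA ler_pdivrMr.
by rewrite ler_wpM2l// expR_ge1Dx.
Qed.

End Greedy.

(** * Volumes of balls and of their images under diagonal affine maps *)

Section Volume.
Context {R : realType}.
Local Notation T := (measurableTypeR R).

Section AffineBalls.
Variable d : nat.
Implicit Types (p q : \bar R) (c s x : 'rV[R]_d).

(** The identification built into [vol], so that [vol A] is by conversion the tuple measure of the
    preimage of [A]. *)
Definition row_of_tuple (t : d.-tuple T) : 'rV[R]_d := \row_i tnth t i.

(** A common form for balls and ellipsoids: a constant [s] gives the ball of that radius around [c],
    and c = 0 with s a multiple of [mu] gives a dilated ellipsoid. *)
Definition affball p c s : set 'rV[R]_d :=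
  [set x | lpnorm p (\row_i ((x 0 i - c 0 i) / s 0 i)) <= 1].

Lemma measurable_bigmax (I : Type) (r : seq I) (h : I -> d.-tuple T -> R) :
  (forall i, measurable_fun setT (h i)) ->
  measurable_fun setT (fun t => \big[Num.max/0]_(i <- r) h i t).
Proof.
move=> mh; elim: r => [|i r IH].
  by under eq_fun do rewrite big_nil; exact: measurable_cst.
by under eq_fun do rewrite big_cons; exact: measurable_maxr.
Qed.

Lemma measurable_lpnorm p : (1 <= p)%E ->
  measurable_fun setT (fun t => lpnorm p (row_of_tuple t)).
Proof.
have mn i : measurable_fun setT (fun t => `|row_of_tuple t 0 i|).
  under eq_fun do rewrite mxE.
  apply: (measurableT_comp (@normr_measurable R setT)).
  exact: measurable_tnth.
move: p; apply: exp_cases => [r r1|] /=; last exact: measurable_bigmax.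
apply: (measurableT_comp (@measurable_powR R _)).
by apply: measurable_sum => i; exact: (measurableT_comp (@measurable_powR R _)).
Qed.

Lemma measurable_lpball p : (1 <= p)%E -> measurable (row_of_tuple @^-1` lpball p).
Proof.
move=> p1; have := measurable_preimageT (measurable_lpnorm p1)
  (measurable_itv `]-oo, 1%R]).
by congr measurable; apply/seteqP; split => t /=; rewrite in_itv.
Qed.

Lemma affball_preimage p c s : row_of_tuple @^-1` affball p c s =
  tuple_fun (fun i (x : T) => (x - c 0 i) / s 0 i : T) @^-1`
    (row_of_tuple @^-1` lpball p).
Proof.
apply/seteqP; split => t /=; rewrite /affball /lpball /=; congr (lpnorm p _ <= 1);
  by apply/rowP => i; rewrite !mxE tnth_mktuple.
Qed.

Lemma measurable_affine (c s : R) :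
  measurable_fun setT (fun x : T => (x - c) / s : T).
Proof. by apply: measurable_funM => //; exact: measurable_funB. Qed.

Lemma measurable_affball p c s : (1 <= p)%E ->
  measurable (row_of_tuple @^-1` affball p c s).
Proof.
move=> p1; rewrite affball_preimage; apply: measurable_preimageT.
  by apply: measurable_tuple_fun => i; exact: measurable_affine.
exact: measurable_lpball.
Qed.

Lemma vol_affball p c s : (1 <= p)%E -> (forall i, 0 < s 0 i) ->
  vol (affball p c s) = ((\prod_i s 0 i)%:E * vol (@lpball R d p))%E.
Proof.
move=> p1 s0.
transitivity (tuple_measure (@lebesgue_measure R) d (row_of_tuple @^-1` affball p c s)).
  by [].
rewrite affball_preimage (@tuple_measure_preimage _ _ _ _ _ _ (fun i => s 0 i))//.
- by move=> i; exact: measurable_affine.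
- by move=> i A mA; exact: lebesgue_measure_affine.
- exact: measurable_lpball.
Qed.

End AffineBalls.

Lemma measurable_cube d (r : R) :
  measurable [set t : d.-tuple T | forall i, `[- r, r]%classic (tnth t i)].
Proof.
rewrite (_ : [set t | _] = \bigcap_(i : 'I_d)
  ((fun t : d.-tuple T => tnth t i) @^-1` `[- r, r]%classic)).
  apply: fin_bigcap_measurable => // i _.
  by apply: measurable_preimageT => //; exact: measurable_tnth.
by apply/seteqP; split => [t /= h i _|t /= h i]; exact: h.
Qed.

Lemma vol_cube d (r : R) : 0 <= r ->
  tuple_measure (@lebesgue_measure R) d
    [set t : d.-tuple T | forall i, `[- r, r]%classic (tnth t i)]
  = ((r + r) ^+ d)%:E.
Proof.
move=> r0; transitivity (\prod_(i < d) lebesgue_measure (`[(- r)%R, r]%classic : set T))%E.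
  by apply: (@tuple_measure_box _ _ _ (@lebesgue_measure R) d (fun=> `[- r, r]%classic)) => i.
under eq_bigr do rewrite lebesgue_measure_itv/= lte_fin.
transitivity (\prod_(i < d) (r + r)%:E)%E.
  (* The interval formula returns 0 unless -r < r; the remaining case is r = 0, where the side r + r
     is also 0. *)
  apply: eq_bigr => i _; case: ltP => [_|rr]; first by rewrite -EFinB opprK.
  by congr (_%:E); lra.
elim: d => [|d IH]; first by rewrite big_ord0 expr0.
by rewrite big_ord_recl IH -EFinM exprS.
Qed.

Variable n : nat.
Implicit Types (p q : \bar R).

(** The ball contains a cube of half-side [D^-1], where [D] is the constant comparing the [p]-norm
    with the maximum norm. *)
Lemma vol_lpball_gt0 p : (1 <= p)%E -> (0 < vol (@lpball R n.+1 p))%E.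
Proof.
move=> p1; set D := n.+1%:R `^ (Num.max (inv_exp p - inv_exp +oo%E) 0) : R.
have D0 : 0 < D by rewrite powR_gt0 ?ltr0n.
have Di0 : 0 <= D^-1 by rewrite invr_ge0 ltW.
have : (((D^-1 + D^-1) ^+ n.+1)%:E <= vol (@lpball R n.+1 p))%E.
  rewrite -vol_cube// /vol; apply: le_measure; rewrite ?inE.
  - exact: measurable_cube.
  - exact: (@measurable_lpball _ p p1).
  - move=> t /= ht; rewrite /lpball /=.
    apply: (le_trans (@lpnorm_le _ _ _ +oo%E _ p1 _)); first by rewrite leey.
    rewrite -/D -ler_pdivlMl// mulr1; apply/lpnorm_ooP => // i.
    by rewrite mxE ler_norml; have := ht i; rewrite /= in_itv.
by apply: lt_le_trans; rewrite lte_fin exprn_gt0// addr_gt0// invr_gt0.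
Qed.

(** Coordinates are bounded by the norm, so the ball lies in the cube of half-side 1. *)
Lemma vol_lpball_lty p : (1 <= p)%E -> (vol (@lpball R n.+1 p) < +oo)%E.
Proof.
move=> p1; have : (vol (@lpball R n.+1 p) <= ((1 + 1) ^+ n.+1)%:E)%E.
  rewrite -vol_cube// /vol; apply: le_measure; rewrite ?inE.
  - exact: (@measurable_lpball _ p p1).
  - exact: measurable_cube.
  - move=> t; rewrite /lpball /= => ht i; rewrite in_itv/= -ler_norml.
    by apply: le_trans ht; have := normr_le_lpnorm (row_of_tuple t) i p1; rewrite mxE.
by move=> /le_lt_trans; apply; exact: ltry.
Qed.

Definition volr p : R := fine (vol (@lpball R n.+1 p)).

Lemma volrE p : (1 <= p)%E -> vol (@lpball R n.+1 p) = (volr p)%:E.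
Proof.
by move=> p1; rewrite fineK// ge0_fin_numE ?vol_lpball_lty.
Qed.

Lemma volr_gt0 p : (1 <= p)%E -> 0 < volr p.
Proof. by move=> p1; rewrite -lte_fin -volrE// vol_lpball_gt0. Qed.

End Volume.

(** * Balls inside dilated ellipsoids, and separated sets *)

Section Covering.
Context {R : realType}.
Variable n : nat.
Local Notation d := n.+1.
Local Notation V := 'rV[R]_d.
Implicit Types (p q : \bar R) (c x y mu : V) (r s eps eta : R).

Lemma lpnorm_mono p x y : (1 <= p)%E -> (forall i, `|x 0 i| <= `|y 0 i|) ->
  lpnorm p x <= lpnorm p y.
Proof.
move=> + xy; move: p; apply: exp_cases => [r r1|].
  have r0 : 0 <= r by exact: le_trans r1.
  apply/lpnorm_finP => //; first exact: lpnorm_ge0.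
  rewrite lpnorm_fin_powR//; apply: ler_sum => i _.
  by apply: ge0_ler_powR; rewrite ?nnegrE.
apply/lpnorm_ooP => [|i]; first exact: lpnorm_ge0.
by apply: le_trans (xy i) _; rewrite (normr_le_lpnorm (p := +oo%E)) ?leey.
Qed.

Lemma affball_const p c r x : (1 <= p)%E -> 0 < r ->
  affball p c (const_mx r) x <-> lpnorm p (x - c) <= r.
Proof.
move=> p1 r0; rewrite /affball /=.
have -> : \row_i ((x 0 i - c 0 i) / (const_mx r : V) 0 i) = r^-1 *: (x - c).
  by apply/rowP => i; rewrite !mxE mulrC.
by rewrite lpnormZ// gtr0_norm ?invr_gt0// ler_pdivrMl// mulr1.
Qed.

Lemma affball_ellipsoid p mu s x : (1 <= p)%E -> 0 < s ->
  affball p 0 (s *: mu) x <-> wlpnorm p mu x <= s.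
Proof.
move=> p1 s0; rewrite /affball /wlpnorm /=.
have -> : \row_i ((x 0 i - (0 : V) 0 i) / (s *: mu) 0 i) = s^-1 *: \row_i (x 0 i / mu 0 i).
  by apply/rowP => i; rewrite !mxE subr0 invfM mulrCA.
by rewrite lpnormZ// gtr0_norm ?invr_gt0// ler_pdivrMl// mulr1.
Qed.

Lemma wlpnormD p mu x y : (1 <= p)%E ->
  wlpnorm p mu (x + y) <= wlpnorm p mu x + wlpnorm p mu y.
Proof.
move=> p1; apply: le_trans (lpnormD _ _ p1).
by rewrite le_eqVlt; apply/orP; left; apply/eqP; congr (lpnorm p _);
  apply/rowP => i; rewrite !mxE mulrDl.
Qed.

(** The last semi-axis is the smallest, so dividing every coordinate by it can only enlarge the
    norm; then [lpnorm_le] changes the exponent. *)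
Lemma wlpnorm_le p q mu x : (1 <= p)%E -> (1 <= q)%E -> semi_axes mu ->
  wlpnorm p mu x <=
  (mu 0 ord_max)^-1 * (d%:R `^ (Num.max (inv_exp p - inv_exp q) 0) * lpnorm q x).
Proof.
move=> p1 q1 [mu0 mu_mono].
apply: (@le_trans _ _ ((mu 0 ord_max)^-1 * lpnorm p x)); last first.
  by rewrite ler_wpM2l ?invr_ge0 ?(ltW (mu0 _))// lpnorm_le.
rewrite -(gtr0_norm (_ : 0 < (mu 0 ord_max)^-1)) ?invr_gt0// -lpnormZ//.
apply: lpnorm_mono => // i; rewrite !mxE normrM [leRHS]normrM mulrC ler_wpM2r//.
rewrite !gtr0_norm ?invr_gt0// lef_pV2 ?posrE//.
by apply: mu_mono; rewrite -ltnS.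
Qed.

(** The bound on [eps] makes the weighted norm of x - c at most [eta]; the triangle inequality adds
    it to that of [c], which is at most 1. *)
Lemma small_ball_sub p q eta mu eps c r :
  (1 <= p)%E -> (1 <= q)%E -> 0 < eta -> semi_axes mu ->
  eps <= eta * d%:R `^ (- Num.max (inv_exp p - inv_exp q) 0) * mu 0 ord_max ->
  ellipsoid p mu c -> 0 < r -> r <= eps ->
  affball q c (const_mx r) `<=` affball p 0 ((1 + eta) *: mu).
Proof.
move=> p1 q1 eta0 hmu; set M := Num.max _ 0 => epsle Ec r0 reps x.
move=> /affball_const-/(_ q1 r0) xc; apply/affball_ellipsoid; rewrite ?addr_gt0//.
have -> : x = c + (x - c) by rewrite addrC subrK.
apply: (le_trans (wlpnormD _ _ _ p1)); apply: lerD => //.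
have mu0 := hmu.1 ord_max.
apply: (le_trans (wlpnorm_le _ p1 q1 hmu)).
rewrite -/M ler_pdivrMl// -ler_pdivlMl ?powR_gt0 ?ltr0n//.
rewrite -powRN; apply: (le_trans xc); apply: (le_trans reps); apply: (le_trans epsle).
by rewrite le_eqVlt; apply/orP; left; apply/eqP; ring.
Qed.

Lemma prod_const_mx (r : R) : \prod_(i < d) (const_mx r : V) 0 i = r ^+ d.
Proof. by under eq_bigr do rewrite mxE; rewrite prodr_const card_ord. Qed.

Lemma vol_ball q c r : (1 <= q)%E -> 0 < r ->
  vol (affball q c (const_mx r)) = (r ^+ d * volr n q)%:E.
Proof.
by move=> q1 r0; rewrite vol_affball ?prod_const_mx ?volrE// => i; rewrite mxE.
Qed.

Lemma vol_ellipsoid p mu s : (1 <= p)%E -> 0 < s -> semi_axes mu ->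
  vol (affball p 0 (s *: mu)) = (s ^+ d * (\prod_i mu 0 i) * volr n p)%:E.
Proof.
move=> p1 s0 [mu0 _]; rewrite vol_affball ?volrE//; last first.
  by move=> i; rewrite mxE mulr_gt0.
rewrite -EFinM; congr (_ * _)%:E.
under eq_bigr do rewrite mxE.
by rewrite big_split/= prodr_const card_ord.
Qed.

Definition separated q r (L : seq V) :=
  uniq L /\ forall x y, x \in L -> y \in L -> x != y -> r < lpnorm q (x - y).

(** A point common to two balls of radius r/2 would put their centers within [r] of each other. *)
Lemma separated_count q r (L : seq V) (t : d.-tuple (measurableTypeR R)) :
  (1 <= q)%E -> 0 < r -> separated q r L ->
  (count (hits (fun c => @row_of_tuple R d @^-1` affball q c (const_mx (r / 2))) t) L <= 1)%N.
Proof.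
move=> q1 r0 [uL sL]; have r20 : 0 < r / 2 by rewrite divr_gt0.
rewrite -size_filter; set F := [seq c <- L | _].
have uF : uniq F by exact: filter_uniq.
have hF c : c \in F -> (c \in L) /\ lpnorm q (row_of_tuple t - c) <= r / 2.
  by rewrite mem_filter /hits => /andP[/set_mem/affball_const-/(_ q1 r20) h cL].
case: F uF hF => [//|x [//|y F]] /= /andP[]; rewrite inE negb_or => /andP[xy _] _ hF.
have [xL hx] := hF x (mem_head _ _).
have [yL hy] : (y \in L) /\ lpnorm q (row_of_tuple t - y) <= r / 2.
  by apply: hF; rewrite !inE eqxx orbT.
have := sL _ _ xL yL xy; rewrite ltNge => /negP[].
have -> : x - y = - (row_of_tuple t - x) + (row_of_tuple t - y).
  by rewrite opprB addrA subrK.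
apply: (le_trans (lpnormD _ _ q1)); rewrite lpnormN//.
by rewrite [leRHS](splitr r) lerD.
Qed.

(** The bound [N] provides a separated list of maximal length; a point of [K] farther than [r] from
    all its entries could be added to it. *)
Lemma exists_net q r (K : set V) (N : nat) : (1 <= q)%E -> 0 < r ->
  (forall L, separated q r L -> {in L, forall x, K x} -> (size L <= N)%N) ->
  exists L : seq V, [/\ separated q r L, {in L, forall x, K x} &
    forall x, K x -> exists2 c, c \in L & lpnorm q (x - c) <= r].
Proof.
move=> q1 r0 hN.
pose P k := `[< exists L : seq V,
  [/\ separated q r L, {in L, forall x, K x} & size L = k] >].
have exP : exists k, P k by exists 0%N; apply/asboolP; exists [::]; split.
have bP k : P k -> (k <= N)%N by move=> /asboolP[L [sL KL <-]]; exact: hN.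
case: (ex_maxnP exP bP) => k /asboolP[L [sL KL Lk]] maxk; exists L; split => // x Kx.
apply: contrapT => hx.
have far c : c \in L -> r < lpnorm q (x - c).
  by move=> cL; rewrite ltNge; apply/negP => h; apply: hx; exists c.
have xL : x \notin L.
  apply/negP => /far; rewrite subrr lpnorm0//.
  by apply/negP; rewrite -leNgt ltW.
have : P k.+1.
  apply/asboolP; exists (x :: L); split => /=; last by rewrite Lk.
    split; first by rewrite /= xL sL.1.
    move=> y z; rewrite !inE => /predU1P[->|yL] /predU1P[->|zL]; rewrite ?eqxx//.
    - by move=> _; exact: far.
    - by move=> _; rewrite -lpnormN// opprB far.
    - exact: sL.2.
  by move=> y; rewrite inE => /predU1P[->//|/KL].
by move=> /maxk; rewrite ltnn.
Qed.

End Covering.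

(** * Volume bounds on the size of covers *)

Section CoveringBounds.
Context {R : realType}.
Variable n : nat.
Local Notation d := n.+1.
Local Notation V := 'rV[R]_d.
Local Notation lebd := (tuple_measure (@lebesgue_measure R) d
  : {measure set (d.-tuple (measurableTypeR R)) -> \bar R}).
Implicit Types (p q : \bar R) (mu : V) (eps eta : R).

Lemma bernoulli_le (k : nat) (x : R) : 0 <= x -> x <= 1 ->
  1 - k%:R * x <= (1 - x) ^+ k.
Proof.
move=> x0 x1; elim: k => [|k IH]; first by rewrite mul0r subr0 expr0.
rewrite exprS (@le_trans _ _ ((1 - x) * (1 - k%:R * x)))//; last first.
  by rewrite ler_wpM2l// subr_ge0.
have -> : (1 - x) * (1 - k%:R * x) = 1 - k.+1%:R * x + k%:R * x ^+ 2.
  by rewrite -natr1; ring.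
by rewrite lerDl mulr_ge0// sqr_ge0.
Qed.

(** The volume of the ellipsoid dilated by [s], over that of an [l^q] ball of radius [eps]; see
    [vol_ellipsoid] and [vol_ball]. *)
Definition volume_ratio p q mu s eps : R :=
  (s ^+ d * (\prod_i mu 0 i) * volr n p) / (eps ^+ d * volr n q).

(** The balls around the centers cover the ellipsoid, so their volumes add up to at least its
    volume. *)
Lemma cover_lower_bound p q mu eps (X : {fset V}) :
  (1 <= p)%E -> (1 <= q)%E -> semi_axes mu -> 0 < eps ->
  is_cover eps (ellipsoid p mu) q X ->
  volume_ratio p q mu 1 eps <= #|` X|%:R.
Proof.
move=> p1 q1 hmu eps0 cX.
rewrite /volume_ratio ler_pdivrMr ?mulr_gt0 ?exprn_gt0 ?volr_gt0//.
pose A := @row_of_tuple R d @^-1` affball p 0 (1 *: mu).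
pose B c := @row_of_tuple R d @^-1` affball q c (const_mx eps).
have mA : measurable A by exact: measurable_affball.
have mB c : measurable (B c) by exact: measurable_affball.
have muB c : lebd (B c) = (eps ^+ d * volr n q)%:E by exact: vol_ball.
have muA : lebd A = (1 ^+ d * (\prod_i mu 0 i) * volr n p)%:E by exact: vol_ellipsoid.
have := @measure_le_sum_cover _ _ _ lebd _ B A mA mB X.
rewrite (sum_measure_const muB) muA.
rewrite lee_fin => h; apply: h => t /affball_ellipsoid-/(_ p1 ltr01) At.
have [c cX' hc] := cX _ At.
rewrite -has_count; apply/hasP; exists c => //.
by apply/mem_set/affball_const.
Qed.

Lemma exists_cover p q mu eps eta :
  (1 <= p)%E -> (1 <= q)%E -> 0 < eta -> semi_axes mu -> 0 < eps ->
  eps <= eta * d%:R `^ (- Num.max (inv_exp p - inv_exp q) 0) * mu 0 ord_max ->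
  exists2 X : {fset V}, is_cover eps (ellipsoid p mu) q X &
    #|` X|%:R <= volume_ratio p q mu (1 + eta) eps * (9 * d%:R ^+ 2) + 1.
Proof.
move=> p1 q1 eta0 hmu eps0 epsle.
have s0 : 0 < 1 + eta by rewrite addr_gt0.
set rho := volume_ratio _ _ _ _ _.
pose D : R := d%:R; have D1 : 1 <= D by rewrite ler1n.
have D0 : 0 < D by exact: lt_le_trans D1.
pose delta : R := (2 * D)^-1.
have delta0 : 0 < delta by rewrite invr_gt0 mulr_gt0.
have delta_le : delta <= 2^-1 by rewrite lef_pV2 ?posrE ?mulr_gt0// ler_peMr.
set a := (1 + eta) ^+ d * (\prod_i mu 0 i) * volr n p.
set w := eps ^+ d * volr n q.
have w0 : 0 < w by rewrite mulr_gt0 ?exprn_gt0 ?volr_gt0.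
have a0 : 0 < a.
  by rewrite !mulr_gt0 ?exprn_gt0 ?volr_gt0// prodr_gt0// => i _; exact: hmu.1.
have rhoE : rho = a / w by [].
have rho0 : 0 < rho by rewrite rhoE divr_gt0.
pose A := @row_of_tuple R d @^-1` affball p 0 ((1 + eta) *: mu).
have mA : measurable A by exact: measurable_affball.
have muA : lebd A = a%:E by exact: vol_ellipsoid.
pose B r c := @row_of_tuple R d @^-1` affball q c (const_mx r).
have mB r c : measurable (B r c) by exact: measurable_affball.
have muB r c : 0 < r -> lebd (B r c) = (r ^+ d * volr n q)%:E.
  by move=> r0; exact: vol_ball.
have BA r c : 0 < r -> r <= eps -> ellipsoid p mu c -> B r c `<=` A.
  by move=> r0 reps Ec t; exact: (small_ball_sub p1 q1 eta0 hmu epsle Ec r0 reps).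
have de0 : 0 < delta * eps by rewrite mulr_gt0.
have de20 : 0 < delta * eps / 2 by rewrite divr_gt0.
(* Packing bound: the half-size balls have radius eps/(4d), lie in [A], and no point belongs to two
   of them. *)
have sep_size L : separated q (delta * eps) L -> {in L, forall x, ellipsoid p mu x} ->
    (size L)%:R <= (4 * D) ^+ d * rho.
  move=> sL KL.
  have := @sum_measure_le_mult _ _ _ lebd _ (B (delta * eps / 2)) A mA (mB _) 1 L.
  rewrite (sum_measure_const (fun c => muB _ c de20)) muA -EFinM lee_fin mul1r.
  have -> : (delta * eps / 2) ^+ d * volr n q = w / (4 * D) ^+ d.
    have -> : delta * eps / 2 = eps / (4 * D) by rewrite /delta; field; rewrite gt_eqF.
    by rewrite expr_div_n mulrAC.
  move=> h; have {h} : (size L)%:R * (w / (4 * D) ^+ d) <= a.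
    apply: h => [c /KL Ec|t _]; last exact: separated_count.
    apply: BA => //; rewrite ler_pdivrMr// mulrC ler_wpM2l ?(ltW eps0)//; lra.
  rewrite mulrA ler_pdivrMr ?exprn_gt0 ?mulr_gt0// => h.
  by rewrite rhoE mulrA ler_pdivlMr// [leRHS]mulrC.
have [L [sL KL net]] : exists L : seq V, [/\ separated q (delta * eps) L,
    {in L, forall x, ellipsoid p mu x} &
    forall x, ellipsoid p mu x -> exists2 c, c \in L & lpnorm q (x - c) <= delta * eps].
  apply: (@exists_net _ _ q _ _ (Num.trunc ((4 * D) ^+ d * rho))) => // L sL KL.
  by rewrite -ltnS -(ltr_nat R) (le_lt_trans (sep_size L sL KL))// truncnS_gt.
(* The radius is reduced by delta eps to leave room for the distance from a point of the ellipsoid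
   to the net. *)
pose r := (1 - delta) * eps.
have r0 : 0 < r by rewrite mulr_gt0// subr_gt0 (le_lt_trans delta_le)// invf_lt1// ltr1n.
have reps : r <= eps by rewrite ger_pMl// gerBl ltW.
set v := r ^+ d * volr n q.
have v0 : 0 < v by rewrite mulr_gt0 ?exprn_gt0 ?volr_gt0.
(* Bernoulli's inequality: (1 - 1/(2d))^d >= 1/2. *)
have vw : w / 2 <= v.
  have -> : v = (1 - delta) ^+ d * w by rewrite /v /w /r exprMn mulrA.
  rewrite mulrC ler_wpM2r ?(ltW w0)//.
  apply: le_trans (bernoulli_le d _ _); rewrite ?(ltW delta0)//; last by lra.
  by rewrite /delta -/D invfM mulrCA divff ?gt_eqF// mulr1; lra.
(* Here 2 rho >= a/v, and d ln(4d) is the logarithm of (4d)^d, the factor that the greedy choice has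
   to remove from the size of the net. *)
pose y := 2 * rho * (D * ln (4 * D)).
have lnD : 0 <= ln (4 * D) by rewrite ln_ge0//; lra.
have y0 : 0 <= y by apply: mulr_ge0; apply: mulr_ge0 => //; exact: ltW.
(* Rounding up costs at most one center, which is the final + 1 in the bound and the reason for N -
   1 in the theorem. *)
pose m := (Num.trunc y).+1.
have my : y <= m%:R by rewrite ltW// truncnS_gt.
have my1 : m%:R <= y + 1 by rewrite -natr1 lerD2r truncn_le.
have [X sX hX] := @greedy_cover _ _ _ lebd _ (B r) A mA (mB r) v a v0
  (fun c => muB r c r0) muA m L (fun c cL => BA r c r0 reps (KL c cL)).
pose rest := [seq c <- L | ~~ has (fun x => hits (B r) x c) X].
exists [fset x in [seq row_of_tuple t | t <- X] ++ rest]%fset.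
  move=> x Ex; have [c cL xc] := net _ Ex.
  have [|ncov] := boolP (has (fun x => hits (B r) x c) X).
    move=> /hasP[t tX /set_mem/affball_const-/(_ q1 r0) tc].
    exists (row_of_tuple t); first by rewrite in_fset /= mem_cat map_f.
    have -> : x - row_of_tuple t = (x - c) + - (row_of_tuple t - c).
      by rewrite opprB addrA subrK.
    apply: (le_trans (lpnormD _ _ q1)); rewrite lpnormN//.
    have -> : eps = delta * eps + r by rewrite /r; ring.
    by rewrite lerD.
  exists c; first by rewrite in_fset /= mem_cat mem_filter ncov cL orbT.
  by apply: (le_trans xc); rewrite ger_pMl//; lra.
have rest_le : (size rest)%:R <= rho.
  rewrite size_filter; apply: (le_trans hX).
  apply: (@le_trans _ _ ((4 * D) ^+ d * rho * expR (- (D * ln (4 * D))))).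
    apply: ler_pM; rewrite ?expR_ge0//; first exact: sep_size.
    (* The choice of [y] makes y (w/2)/a equal to d ln(4d), and m v/a is at least as large. *)
    rewrite ler_expR lerN2 (@le_trans _ _ (y * (w / 2 / a)))//.
      by rewrite le_eqVlt /y rhoE; apply/orP; left; apply/eqP; field; rewrite !gt_eqF.
    apply: ler_pM => //; first by rewrite !divr_ge0 ?(ltW w0) ?(ltW a0).
    by rewrite ler_wpM2r ?invr_ge0 ?(ltW a0).
  rewrite expRN -[D in expR (D * _)]/(d%:R) mulrC expRM_natl lnK ?posrE ?mulr_gt0//.
  by rewrite mulrA mulVf ?mul1r// gt_eqF// exprn_gt0// mulr_gt0.
have card_le : (#|` [fset x in [seq row_of_tuple t | t <- X] ++ rest]%fset| <=
    m + size rest)%N.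
  rewrite card_fseq (leq_trans (size_undup _))// size_cat size_map leq_add2r.
  exact: sX.
apply: (@le_trans _ _ (m + size rest)%:R); first by rewrite ler_nat.
rewrite natrD; apply: (@le_trans _ _ (y + 1 + rho)); first exact: lerD.
rewrite addrAC lerD2r /y.
have lnle : ln (4 * D) <= 4 * D.
  have /le_ln1Dx : -1 < 4 * D - 1 by lra.
  by rewrite addrC subrK => /le_trans; apply; lra.
(* The constant is 9 = 8 + 1: the greedy centers give 8 d^2 through ln(4d) <= 4d, and the uncovered
   points give 1 <= d^2. *)
have -> : rho * (9 * D ^+ 2) = 2 * rho * (D * (4 * D)) + rho * D ^+ 2 by ring.
apply: lerD; last by rewrite ler_peMr ?(ltW rho0)// exprn_ege1.
by apply: ler_wpM2l; [apply: mulr_ge0 => //; exact: ltW|apply: ler_wpM2l => //; exact: ltW].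
Qed.

End CoveringBounds.

(** * The sequence [kappa] and its asymptotics *)

Section Kappa.
Context {R : realType}.

Definition kappa (d : nat) : R := (9 * d%:R ^+ 2) `^ d%:R^-1.

Lemma expR_sub1_le (u : R) : expR u - 1 <= u * expR u.
Proof.
have : (1 - u) * expR u <= expR (- u) * expR u.
  by rewrite ler_wpM2r ?expR_ge0// expR_ge1Dx.
by rewrite -expRD addNr expR0 mulrBl mul1r lerBlDr addrC -lerBlDr.
Qed.

(** Write kappa(d) = e^u with u = ln(9 d^2)/d. For d >= 2 one has u <= 6 ln(d)/d <= 6, hence e^u - 1
    <= u e^u <= 6 e^6 ln(d)/d. *)
Lemma kappa_asymp : kappa = cst 1 +O_\oo (fun d => log2 d%:R / d%:R :> R).
Proof.
apply/eqaddOP/bigO_exP.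
have ln2 : 0 < ln 2 :> R by rewrite ln_gt0// ltr1n.
(* The factor [ln 2] converts the binary logarithm to the natural one. *)
exists (6 * expR 6 * ln 2); first by rewrite !mulr_gt0// expR_gt0.
exists 2%N => // d /= d2.
have D2 : 2 <= d%:R :> R by rewrite ler_nat.
set D : R := d%:R in D2 *.
have D0 : 0 < D by exact: lt_le_trans D2.
have lnD : 0 <= ln D by rewrite ln_ge0// (le_trans _ D2)// ler1n.
have D9 : 1 <= 9 * D ^+ 2.
  have : 1 <= D ^+ 2 by rewrite exprn_ege1// (le_trans _ D2)// ler1n.
  by lra.
(* Since 9 <= 2^4 <= d^4, one has 9 d^2 <= d^6. *)
have ln9 : ln (9 * D ^+ 2) <= 6 * ln D.
  rewrite [6 * _]mulr_natl -lnXn// ler_ln ?posrE ?exprn_gt0// ?(lt_le_trans ltr01)//.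
  rewrite (exprD D 4 2) ler_wpM2r ?exprn_ge0 ?(ltW D0)//.
  rewrite (@le_trans _ _ (2 ^+ 4))//; last by rewrite lerXn2r ?nnegrE ?(ltW D0).
  by rewrite -natrX ler_nat.
pose u := D^-1 * ln (9 * D ^+ 2).
have kE : kappa d = expR u.
  by rewrite /kappa /powR gt_eqF// (lt_le_trans ltr01).
have u0 : 0 <= u by rewrite mulr_ge0 ?invr_ge0 ?(ltW D0) ?ln_ge0.
have u6 : u <= 6 * (ln D / D) by rewrite /u [leLHS]mulrC mulrA ler_wpM2r ?invr_ge0 ?(ltW D0).
have lnDD : ln D / D <= 1.
  rewrite ler_pdivrMr// mul1r; have /le_ln1Dx : -1 < D - 1 by lra.
  by rewrite addrC subrK => /le_trans; apply; lra.
rewrite -[(kappa - cst 1) d]/(kappa d - 1) kE /log2.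
rewrite ger0_norm; last by rewrite subr_ge0 -expR0 ler_expR.
rewrite ger0_norm ?divr_ge0 ?(ltW D0) ?(ltW ln2)//.
apply: (le_trans (expR_sub1_le u)).
have -> : 6 * expR 6 * ln 2 * (ln D / ln 2 / D) = 6 * (ln D / D) * expR 6.
  by field; rewrite !gt_eqF.
by apply: ler_pM; rewrite ?expR_ge0// ler_expR; lra.
Qed.

End Kappa.

(** * From volume ratios to covering numbers and their [d]-th roots *)

Section CoveringNumber.
Context {R : realType}.
Variable n : nat.
Local Notation d := n.+1.
Local Notation V := 'rV[R]_d.
Implicit Types (p q : \bar R) (mu : V) (eps eta s : R).

Lemma covering_number_sub (K K' : set V) eps q : K `<=` K' ->
  (covering_number eps K q <= covering_number eps K' q)%E.
Proof.
move=> KK'; apply: le_ereal_inf_tmp => _ [X cX <-]; apply: ereal_inf_lbound.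
by exists X => // x /KK'; exact: cX.
Qed.

(** Makes N - 1 nonnegative, as the monotonicity of the [d]-th root on [0, +oo] demands. *)
Lemma covering_number_ge1 (K : set V) eps q : K !=set0 ->
  (1 <= covering_number eps K q)%E.
Proof.
move=> [x Kx]; apply: le_ereal_inf_tmp => _ [X cX <-].
have [c cX' _] := cX x Kx; rewrite lee_fin ler1n cardfs_gt0.
by apply/fset0Pn; exists c.
Qed.

Lemma ellipsoid_neq0 p mu : (1 <= p)%E -> ellipsoid p mu !=set0.
Proof.
move=> p1; exists 0; rewrite /ellipsoid /wlpnorm /=.
rewrite (_ : \row_i _ = 0) ?lpnorm0//.
by apply/rowP => i; rewrite !mxE mul0r.
Qed.

(** The ratio factors as (s/eps)^d, the quotient of the unit ball volumes, and the product of the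
    semi-axes; the root is taken of each factor. *)
Lemma volume_ratio_root p q mu s eps : (1 <= p)%E -> (1 <= q)%E -> semi_axes mu ->
  0 < s -> 0 < eps ->
  volume_ratio p q mu s eps `^ d%:R^-1 * eps = s * Vratio p q d * geomean mu.
Proof.
move=> p1 q1 [mu0 _] s0 eps0.
have rootX (x : R) : 0 < x -> (x ^+ d) `^ d%:R^-1 = x.
  by move=> x0; rewrite -powR_mulrn ?(ltW x0)// powRKV ?ltr0n// ltW.
have prod0 : 0 <= \prod_i mu 0 i by apply: prodr_ge0 => i _; exact: ltW.
have vp := ltW (volr_gt0 n p1); have vq := ltW (volr_gt0 n q1).
have -> : volume_ratio p q mu s eps =
    (s / eps) ^+ d * (volr n p / volr n q) * \prod_i mu 0 i.
  rewrite /volume_ratio expr_div_n; field.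
  by rewrite !gt_eqF ?exprn_gt0 ?volr_gt0.
have se : 0 <= (s / eps) ^+ d by rewrite exprn_ge0// divr_ge0// ltW.
have vv : 0 <= volr n p / volr n q by rewrite divr_ge0.
rewrite (powRM _ (mulr_ge0 se vv) prod0) (powRM _ se vv).
rewrite rootX ?divr_gt0// -[_ `^ _]/(Vratio p q d) -[(\prod_i _) `^ _]/(geomean mu).
by field; rewrite gt_eqF.
Qed.

Lemma upper_bound p q eta mu eps : (1 <= p)%E -> (1 <= q)%E -> 0 < eta ->
  semi_axes mu -> 0 < eps ->
  eps <= eta * d%:R `^ (- Num.max (inv_exp p - inv_exp q) 0) * mu 0 ord_max ->
  ((covering_number eps (ellipsoid p mu) q - 1) `^ (d%:R^-1) * eps%:E
    <= (kappa d * (1 + eta) * Vratio p q d * geomean mu)%:E)%E.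
Proof.
move=> p1 q1 eta0 hmu eps0 epsle.
have [X cX sX] := exists_cover p1 q1 eta0 hmu eps0 epsle.
set rho := volume_ratio _ _ _ _ _ in sX.
have rho0 : 0 <= rho.
  rewrite /rho /volume_ratio divr_ge0 ?mulr_ge0 ?exprn_ge0 ?(ltW (volr_gt0 _ _)) ?addr_ge0 ?(ltW eps0) ?(ltW eta0)//.
  by apply: prodr_ge0 => i _; exact/ltW/hmu.1.
have N1 := covering_number_ge1 eps q (ellipsoid_neq0 mu p1).
set N := covering_number _ _ _ in N1 *.
have NX : (N <= (rho * (9 * d%:R ^+ 2) + 1)%:E)%E.
  apply: (@le_trans _ _ (#|` X|%:R)%:E); last by rewrite lee_fin.
  by apply: ereal_inf_lbound; exists X.
have NX1 : (N - 1 <= (rho * (9 * d%:R ^+ 2))%:E)%E.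
  by rewrite leeBlDr// -EFinD.
have P0 : 0 <= 9 * d%:R ^+ 2 :> R by rewrite mulr_ge0// exprn_ge0.
apply: (@le_trans _ _ ((rho * (9 * d%:R ^+ 2))%:E `^ (d%:R^-1) * eps%:E)%E).
  rewrite lee_wpmul2r ?lee_fin ?(ltW eps0)//; apply: gt0_ler_poweR => //.
  - by rewrite in_itv/= leey andbT; rewrite -sube_ge0// in N1.
  - by rewrite in_itv/= leey andbT lee_fin mulr_ge0.
rewrite poweR_EFin -EFinM lee_fin powRM// mulrAC.
rewrite volume_ratio_root ?addr_gt0// le_eqVlt; apply/orP; left; apply/eqP.
by rewrite /kappa; ring.
Qed.

Lemma lower_bound p q mu eps : (1 <= p)%E -> (1 <= q)%E -> semi_axes mu -> 0 < eps ->
  ((Vratio p q d * geomean mu)%:E <=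
    covering_number eps (ellipsoid p mu) q `^ (d%:R^-1) * eps%:E)%E.
Proof.
move=> p1 q1 hmu eps0.
have -> : Vratio p q d * geomean mu = volume_ratio p q mu 1 eps `^ d%:R^-1 * eps.
  by rewrite volume_ratio_root// mul1r.
rewrite EFinM lee_wpmul2r ?lee_fin ?(ltW eps0)// -poweR_EFin.
have NV : ((volume_ratio p q mu 1 eps)%:E <= covering_number eps (ellipsoid p mu) q)%E.
  by apply: le_ereal_inf_tmp => _ [X cX <-]; rewrite lee_fin cover_lower_bound.
have V0 : 0 <= volume_ratio p q mu 1 eps.
  rewrite /volume_ratio divr_ge0 ?mulr_ge0 ?exprn_ge0 ?(ltW (volr_gt0 _ _)) ?(ltW eps0)//.
  by apply: prodr_ge0 => i _; exact/ltW/hmu.1.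
apply: gt0_ler_poweR => //.
- by rewrite in_itv/= leey andbT lee_fin.
- by rewrite in_itv/= leey andbT (le_trans _ NV).
Qed.

Lemma semi_axesZ s mu : 0 < s -> semi_axes mu -> semi_axes (s *: mu).
Proof.
move=> s0 [mu0 mono]; split => [i|i j ij]; rewrite !mxE ?mulr_gt0//.
by rewrite ler_wpM2l ?(ltW s0)// mono.
Qed.

Lemma geomeanZ s mu : 0 < s -> semi_axes mu -> geomean (s *: mu) = s * geomean mu.
Proof.
move=> s0 [mu0 _]; rewrite /geomean; under eq_bigr do rewrite mxE.
rewrite big_split/= prodr_const card_ord powRM ?exprn_ge0 ?(ltW s0)//.
  by rewrite -powR_mulrn ?(ltW s0)// powRKV ?ltr0n// ltW.
by apply: prodr_ge0 => i _; exact: ltW.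
Qed.

Lemma Vratio_refl q : (1 <= q)%E -> Vratio q q d = 1 :> R.
Proof.
move=> q1; rewrite /Vratio divff ?powR1//.
by rewrite gt_eqF// -/(volr n q) volr_gt0.
Qed.

(** Norm comparison applied to the weighted vector. This inclusion reduces [FD2] to the case of
    equal exponents. *)
Lemma ellipsoid_sub p q mu : (1 <= q)%E -> (q <= p)%E ->
  ellipsoid p mu `<=` ellipsoid q (d%:R `^ (inv_exp q - inv_exp p) *: mu).
Proof.
move=> q1 qp x; have p1 := le_trans q1 qp; rewrite /ellipsoid /= => h.
set s := d%:R `^ _; have s0 : 0 < s by rewrite powR_gt0 ?ltr0n.
rewrite /wlpnorm (_ : \row_i _ = s^-1 *: \row_i (x 0 i / mu 0 i)); last first.
  by apply/rowP => i; rewrite !mxE invfM mulrCA.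
rewrite lpnormZ// gtr0_norm ?invr_gt0// ler_pdivrMl// mulr1.
apply: (le_trans (lpnorm_le _ q1 p1)).
rewrite max_l ?subr_ge0 ?le_inv_exp// -/s -[leRHS]mulr1.
by rewrite ler_wpM2l ?(ltW s0).
Qed.

End CoveringNumber.

Theorem theorem8 (R : realType) :
  (forall (p q : \bar R) (n : nat) (mu : 'rV[R]_n.+1),
     (1 <= p)%E -> (1 <= q)%E -> semi_axes mu ->
     forall eps : R, 0 < eps ->
       ((Vratio p q n.+1 * geomean mu)%:E <=
        covering_number eps (ellipsoid p mu) q `^ (n.+1%:R^-1) * eps%:E)%E)
  /\
  exists kappa : nat -> R,
    (kappa = cst 1 +O_\oo (fun d => log2 d%:R / d%:R)) /\
    forall (p q : \bar R) (eta : R) (n : nat) (mu : 'rV[R]_n.+1),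
      (1 <= p)%E -> (1 <= q)%E -> 0 < eta -> semi_axes mu ->
      (forall eps : R, 0 < eps ->
         eps <= eta * n.+1%:R `^ (- Num.max (inv_exp p - inv_exp q) 0)
                * mu 0 ord_max ->
         ((covering_number eps (ellipsoid p mu) q - 1) `^ (n.+1%:R^-1) * eps%:E
          <= (kappa n.+1 * (1 + eta) * Vratio p q n.+1 * geomean mu)%:E)%E)
      /\
      (forall eps : R, (q <= p)%E -> 0 < eps ->
         eps <= eta * n.+1%:R `^ (inv_exp q - inv_exp p) * mu 0 ord_max ->
         ((covering_number eps (ellipsoid p mu) q - 1) `^ (n.+1%:R^-1) * eps%:E
          <= (kappa n.+1 * (1 + eta) * n.+1%:R `^ (inv_exp q - inv_exp p)
              * geomean mu)%:E)%E).
Proof.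
split=> [p q n mu p1 q1 hmu eps eps0|]; first exact: lower_bound.
exists (@kappa R); split; first exact: kappa_asymp.
move=> p q eta n mu p1 q1 eta0 hmu; split=> [eps eps0|eps qp eps0].
  exact: upper_bound.
(* [FD2] is the upper bound with both exponents equal to [q] for the enclosing ellipsoid with
   semi-axes [s *: mu]: the volume factor is then 1, the geometric mean gains the factor [s], and so
   does the admissible range of [eps]. *)
set s := _ `^ _ => epsle; have s0 : 0 < s by rewrite powR_gt0 ?ltr0n.
have smu := semi_axesZ s0 hmu.
have := @upper_bound R n q q eta (s *: mu) eps q1 q1 eta0 smu eps0.
rewrite subrr max_l// oppr0 powRr0 mulr1 mxE mulrA => /(_ epsle).
rewrite Vratio_refl// mulr1 geomeanZ// mulrA; apply: le_trans.
have sub := covering_number_sub eps q (ellipsoid_sub (mu := mu) q1 qp).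
have N1 := covering_number_ge1 eps q (ellipsoid_neq0 mu p1).
rewrite lee_wpmul2r ?lee_fin ?(ltW eps0)//; apply: gt0_ler_poweR => //.
- by rewrite in_itv/= leey andbT; rewrite -sube_ge0// in N1.
- by have := le_trans N1 sub; rewrite in_itv/= leey andbT -sube_ge0.
- exact: leeB.
Qed.
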